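(* Let $n \geq 2$ and $f \in C_0^{\infty}(\mathbb{R}^n\setminus\{0\})$. Then \[ \mathbf{R}_{n}^2 \left\|\frac{f}{|x|^2}\right\|_{2}^2 = \|\Delta_r f \|_{2}^2 - \left\| \Delta_r f + \mathbf{R}_{n} \frac{f}{|x|^2} \right\|_{2}^2 - 2\mathbf{R}_{n} \left\| \frac{f_*}{|x|} \right\|_{2}^2 = \|\Delta_r f \|_{2}^2 - \Big(1+\frac12\mathbf{R}_n\Big) \left\| \Delta_r f + \mathbf{R}_{n} \frac{f}{|x|^2} \right\|_{2}^2 + \frac12\mathbf{R}_{n} \|f_{\#}\|_{2}^2 \] and \[ \|\Delta f\|_{2}^2 = \|\Delta_r f \|_{2}^2 + \left\| \sum_{j=1}^n L_j^2f \right\|_{2}^2 + 2\mathbf{R}_{n} \sum_{j=1}^n \left\| \frac{L_jf}{|x|} \right\|_{2}^2 + 2\left\langle -\sum_{j=1}^n L_j^2 f_*, f_* \right\rangle, \] where \[ f_* = \partial_r f + \frac{n-4}{2} \frac{f}{|x|}, \qquad f_{\#} = \partial_r^2f+(n-3)\frac{\partial_rf}{|x|} + \frac{(n-4)^2}{4} \frac{f}{|x|^2}. \]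
   Context: $\|\cdot\|_2$ and $\langle\cdot,\cdot\rangle$ denote the norm and inner product of $L^2(\mathbb{R}^n)$ (Lebesgue measure); functions may be complex-valued. $\mathbf{R}_n = \frac{n(n-4)}{4}$. $\Delta$ is the standard Laplacian on $\mathbb{R}^n$. The radial derivative is $\partial_r = \frac{x}{|x|}\cdot\nabla$, the radial Laplacian is $\Delta_r f = \partial_r^2 f + \frac{n-1}{|x|}\partial_r f$, and the spherical-type derivatives are $L_j = \partial_j - \frac{x_j}{|x|}\partial_r$ for $j=1,\ldots,n$. *)

(* Defs.v *)
From HB Require Import structures.
From mathcomp Require Import all_boot all_order all_algebra.
From mathcomp Require Import all_classical all_reals all_analysis.
From mathcomp Require Import complex.

Set Implicit Arguments.
Unset Strict Implicit.
Unset Printing Implicit Defensive.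

Import Order.TTheory GRing.Theory Num.Theory.
Import numFieldNormedType.Exports.

Local Open Scope classical_set_scope.
Local Open Scope ring_scope.

(* R^n is 'rV[R]_n, equipped here with the sigma-algebra generated by the
   coordinate maps (for n-tuples the library does the same). *)
Definition measure_rV_display : measure_display -> measure_display.
Proof. exact. Qed.

Section measurable_rV.
Context {R : realType} {n : nat}.

Let coors : 'I_n -> 'rV[R]_n -> measurableTypeR R := fun i x => x ord0 i.

Let rV_set0 : g_sigma_preimage coors set0.
Proof. exact: sigma_algebra0. Qed.

Let rV_setC A : g_sigma_preimage coors A -> g_sigma_preimage coors (~` A).
Proof. exact: sigma_algebraC. Qed.

Let rV_bigcup (F : _^nat) : (forall i, g_sigma_preimage coors (F i)) ->
  g_sigma_preimage coors (\bigcup_i (F i)).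
Proof. exact: sigma_algebra_bigcup. Qed.

HB.instance Definition _ := @isMeasurable.Build
  (measure_rV_display default_measure_display)
  'rV[R]_n (g_sigma_preimage coors) rV_set0 rV_setC rV_bigcup.

Lemma measurable_coord (i : 'I_n) :
  measurable_fun [set: 'rV[R]_n] (coors i).
Proof.
move=> _ Y mY; rewrite setTI; apply: sub_sigma_algebra => /=.
rewrite -bigcup_seq/=; exists i => /=; first by rewrite mem_index_enum.
by exists Y => //; rewrite setTI.
Qed.

Lemma measurable_fun_rV d (T : measurableType d) (f : T -> 'rV[R]_n) :
  (forall i, measurable_fun [set: T] (coors i \o f)) ->
  measurable_fun [set: T] f.
Proof.
move=> mf; have : g_sigma_preimage (fun i => coors i \o f) `<=` measurable.
  apply: smallest_sub; first exact: sigma_algebra_measurable.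
  case: n coors f mf => [|m] c f mf; first by rewrite big_ord0.
  rewrite -bigcup_mkord_ord; apply: bigcup_sub => i Ii.
  by move=> A [B mB <-]; exact: mf.
by rewrite g_sigma_preimage_comp => prefS _ A mA; apply: prefS; exists A.
Qed.

End measurable_rV.

(* Reproved because sigma-finiteness of \x is not inferred: the library's
   instance is shadowed by the one for subprobabilities. *)
Lemma product_sigma_finite d1 d2 (T1 : measurableType d1)
    (T2 : measurableType d2) (R : realType)
    (m1 : {sigma_finite_measure set T1 -> \bar R})
    (m2 : {sigma_finite_measure set T2 -> \bar R}) :
  sigma_finite setT (m1 \x m2)%E.
Proof.
have /sigma_finiteP[F [TF ndF Foo]] := sigma_finiteT m1.
have /sigma_finiteP[G [TG ndG Goo]] := sigma_finiteT m2.
exists (fun n => F n `*` G n).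
  rewrite -setXTT TF TG predeqE => -[x y]; split.
    move=> [/= [n _ Fnx] [k _ Gky]]; exists (maxn n k) => //; split.
    - by move: x Fnx; exact/subsetPset/ndF/leq_maxl.
    - by move: y Gky; exact/subsetPset/ndG/leq_maxr.
  by move=> [n _ []/= ? ?]; split; exists n.
move=> k; have [mF Fk] := Foo k; have [mG Gk] := Goo k.
split; first exact: measurableX.
by rewrite product_measure1E// lte_mul_pinfty// ge0_fin_numE.
Qed.

Section lebesgue_measure_rV.
Context {R : realType}.

Definition cons_rV n (p : measurableTypeR R * 'rV[R]_n) : 'rV[R]_n.+1 :=
  \row_i oapp (p.2 ord0) p.1 (unlift ord0 i).

Definition uncons_rV n (x : 'rV[R]_n.+1) : measurableTypeR R * 'rV[R]_n :=
  (x ord0 ord0, \row_i x ord0 (lift ord0 i)).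

Lemma cons_rVK n : cancel (@cons_rV n) (@uncons_rV n).
Proof.
move=> [a x]; congr pair; first by rewrite mxE unlift_none.
by apply/rowP => i; rewrite !mxE liftK.
Qed.

Lemma measurable_cons_rV n : measurable_fun setT (@cons_rV n).
Proof.
apply: measurable_fun_rV => i; case: (unliftP ord0 i) => [j|] ->.
  rewrite (_ : _ \o _ = (fun x : 'rV[R]_n => x ord0 j) \o snd); last first.
    by apply/funext => p /=; rewrite mxE liftK.
  exact: measurableT_comp (measurable_coord j) measurable_snd.
rewrite (_ : _ \o _ = fst); first exact: measurable_fst.
by apply/funext => p /=; rewrite mxE unlift_none.
Qed.

Lemma measurable_uncons_rV n : measurable_fun setT (@uncons_rV n).
Proof.
apply/measurable_fun_pairP; split; first exact: measurable_coord.
apply: measurable_fun_rV => i.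
rewrite (_ : _ \o _ = fun x : 'rV[R]_n.+1 => x ord0 (lift ord0 i)).
  exact: measurable_coord.
by apply/funext => x /=; rewrite mxE.
Qed.

Section step.
Variables (n : nat) (mu : {sigma_finite_measure set 'rV[R]_n -> \bar R}).

Definition lebesgue_rV_step : set 'rV[R]_n.+1 -> \bar R :=
  pushforward (lebesgue_measure \x mu)%E (@cons_rV n).

Let step0 : lebesgue_rV_step set0 = 0%E.
Proof. by rewrite /lebesgue_rV_step /pushforward preimage_set0 measure0. Qed.

Let step_ge0 A : (0 <= lebesgue_rV_step A)%E.
Proof. by rewrite /lebesgue_rV_step /pushforward measure_ge0. Qed.

Let step_sigma_additive : semi_sigma_additive lebesgue_rV_step.
Proof.
move=> F mF tF mUF; rewrite /lebesgue_rV_step /pushforward preimage_bigcup.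
have mpre A : measurable A -> measurable (@cons_rV n @^-1` A).
  by move=> mA; rewrite -[X in measurable X]setTI; exact: measurable_cons_rV.
apply: measure_semi_sigma_additive => [k||]; first exact: mpre.
- apply/trivIsetP => /= i j _ _ ij; rewrite -preimage_setI.
  by move/trivIsetP : tF => /(_ _ _ _ _ ij) ->//; rewrite preimage_set0.
- by rewrite -preimage_bigcup; exact: mpre.
Qed.

HB.instance Definition _ := isMeasure.Build _ _ _ lebesgue_rV_step
  step0 step_ge0 step_sigma_additive.

Let step_sigma_finite : sigma_finite setT lebesgue_rV_step.
Proof.
have [F UF mF] := product_sigma_finite (@lebesgue_measure R) mu.
exists (fun k => @uncons_rV n @^-1` F k).
  by rewrite -preimage_bigcup -UF preimage_setT.
move=> k; have [mFk Fkoo] := mF k; split.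
  by rewrite -[X in measurable X]setTI; exact: measurable_uncons_rV.
rewrite /lebesgue_rV_step /pushforward -comp_preimage.
by rewrite (_ : _ \o _ = id) //; apply/funext => p; exact: cons_rVK.
Qed.

HB.instance Definition _ := Measure_isSigmaFinite.Build _ _ _
  lebesgue_rV_step step_sigma_finite.

End step.

(* n-dimensional Lebesgue measure, as the n-fold product of the
   one-dimensional one; lebesgue_rV_box gives its value on boxes. *)
Fixpoint lebesgue_rV n : {sigma_finite_measure set 'rV[R]_n -> \bar R} :=
  match n with
  | 0 => \d_(0 : 'rV[R]_0)
  | n'.+1 => lebesgue_rV_step (lebesgue_rV n')
  end.

End lebesgue_measure_rV.
Arguments lebesgue_rV {R} n.

Lemma lebesgue_rV_box (R : realType) n (A : 'I_n -> set (measurableTypeR R)) :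
  (forall i, measurable (A i)) ->
  lebesgue_rV n [set x : 'rV[R]_n | forall i, A i (x ord0 i)] =
  (\prod_(i < n) lebesgue_measure (A i))%E.
Proof.
elim: n A => [|n IH] A mA.
  rewrite big_ord0 /= diracE mem_set//=; by case.
rewrite big_ord_recl -(IH (fun i => A (lift ord0 i)))// -product_measure1E//.
  rewrite /= /lebesgue_rV_step /pushforward; congr (product_measure1 _ _ _).
  apply/seteqP; split => [[a x] /= H|[a x] /= [Aa H] i].
    split=> [|i]; first by have := H ord0; rewrite mxE unlift_none.
    by have := H (lift ord0 i); rewrite mxE liftK.
  by rewrite mxE; case: unliftP => [j|] ->.
rewrite (_ : [set _ | _] = \bigcap_(i in [set: 'I_n])
    ((fun x : 'rV[R]_n => x ord0 i) @^-1` A (lift ord0 i))).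
  apply: fin_bigcap_measurable => // i _; rewrite -[X in measurable X]setTI.
  exact: measurable_coord.
by apply/seteqP; split => [x H i _|x H i] /=; exact: H.
Qed.

Section functions.
Context {R : realType} {n : nat}.
Local Open Scope complex_scope.
Implicit Types f g : 'rV[R]_n -> R[i].

(* The library norm of 'rV[R]_n is the sup norm. *)
Definition enorm (x : 'rV[R]_n) : R := Num.sqrt (\sum_j x ord0 j ^+ 2).

(* R[i] carries no topology in the library, so limits and derivatives of
   complex-valued functions are taken on real and imaginary parts. *)
Definition partial (j : 'I_n) f : 'rV[R]_n -> R[i] := fun x =>
  'D_(delta_mx ord0 j) (fun y => complex.Re (f y)) x +i*
  'D_(delta_mx ord0 j) (fun y => complex.Im (f y)) x.

Definition partials (s : seq 'I_n) f : 'rV[R]_n -> R[i] := foldr partial f s.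

Definition smooth f : Prop := forall s : seq 'I_n,
  [/\ continuous (fun x => complex.Re (partials s f x)),
      continuous (fun x => complex.Im (partials s f x)) &
      forall (j : 'I_n) (x : 'rV[R]_n),
        derivable (fun y => complex.Re (partials s f y)) x (delta_mx ord0 j) /\
        derivable (fun y => complex.Im (partials s f y)) x (delta_mx ord0 j)].

Definition support f : set 'rV[R]_n := closure [set x | f x != 0].

(* C_0^oo(R^n \ {0}), each function being extended by 0 at the origin. *)
Definition test_function f : Prop :=
  [/\ smooth f, compact (support f) & ~ support f 0].

(* f / |x|^k; at the origin, where the inverse of 0 is 0, the value is
   immaterial for what follows. *)
Definition over_norm (k : nat) f : 'rV[R]_n -> R[i] := fun x =>
  f x / (enorm x ^+ k)%:C.

(* d_r = (x / |x|) . grad. *)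
Definition radial f : 'rV[R]_n -> R[i] := fun x =>
  \sum_(j < n) (x ord0 j / enorm x)%:C * partial j f x.

Definition radial_laplacian f : 'rV[R]_n -> R[i] := fun x =>
  radial (radial f) x + (n%:R - 1) * over_norm 1 (radial f) x.

Definition laplacian f : 'rV[R]_n -> R[i] := fun x =>
  \sum_(j < n) partial j (partial j f) x.

(* L_j = d_j - (x_j / |x|) d_r. *)
Definition spherical (j : 'I_n) f : 'rV[R]_n -> R[i] := fun x =>
  partial j f x - (x ord0 j / enorm x)%:C * radial f x.

Definition sum_spherical2 f : 'rV[R]_n -> R[i] := fun x =>
  \sum_(j < n) spherical j (spherical j f) x.

Definition f_star f : 'rV[R]_n -> R[i] := fun x =>
  radial f x + (n%:R - 4) / 2 * over_norm 1 f x.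

Definition f_sharp f : 'rV[R]_n -> R[i] := fun x =>
  radial (radial f) x + (n%:R - 3) * over_norm 1 (radial f) x
  + (n%:R - 4) ^+ 2 / 4 * over_norm 2 f x.

(* Real-valued through [fine], hence meaningful only when the integral is
   finite, as for continuous functions with compact support. *)
Definition L2norm f : R :=
  fine ('N[lebesgue_rV n]_2%:E
    [(fun x => (ComplexField.Normc.normc (f x))%:E)])%E.

(* Linear in the first argument. *)
Definition L2inner f g : R[i] :=
  (\int[lebesgue_rV n]_x complex.Re (f x * (g x)^*)) +i*
  (\int[lebesgue_rV n]_x complex.Im (f x * (g x)^*)).

End functions.

Definition rellich_const (R : realType) (n : nat) : R := n%:R * (n%:R - 4) / 4.

(* Main.v *)
Require Import Defs.
From HB Require Import structures.
From mathcomp Require Import all_boot all_order all_algebra.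
From mathcomp Require Import all_classical all_reals all_analysis.
From mathcomp Require Import complex ring lra measurable_realfun.

(* Every operator involved is linear with real coefficients, so the identities
   may be proved for the real and imaginary parts of f separately and added.
   Real functions that are smooth, vanish near 0 and have bounded support are
   stable under products, partial derivatives and multiplication by x_j and
   1/|x|; for such a V the divergence of (x/|x|) V is d_r V + (n-1)/|x| V, so
   the latter integrates to 0, and each radial identity holds because the two
   integrands differ by an expression of this form. For the Laplacian, one has
   Delta = Delta_r + sum_j L_j^2, and sum_j x_j L_j = 0 gives the integration
   by parts int u sum_j L_j^2 v = - sum_j int (L_j u)(L_j v); since
   L_j d_r = d_r L_j + L_j/|x|, the cross term 2 <Delta_r f, sum_j L_j^2 f>
   then reduces to a radial identity for each b = L_j f. *)

Set Implicit Arguments.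
Unset Strict Implicit.
Unset Printing Implicit Defensive.

Import Order.TTheory GRing.Theory Num.Theory.
Import numFieldNormedType.Exports.
Local Open Scope classical_set_scope.
Local Open Scope ring_scope.
Local Open Scope complex_scope.

(** * Continuous functions with bounded support and Lebesgue measure *)

Section measure_rV.
Context {R : realType}.

Lemma ler_coord_norm n (x : 'rV[R]_n) i : `|x ord0 i| <= `|x|.
Proof.
rewrite [leRHS]/Num.Def.normr /= mx_normrE; apply/bigmax_geP; right.
by exists (ord0, i).
Qed.

Lemma norm_ler_coord n (x : 'rV[R]_n) M :
  0 <= M -> (forall i, `|x ord0 i| <= M) -> `|x| <= M.
Proof.
move=> M0 xM; rewrite [leLHS]/Num.Def.normr /= mx_normrE; apply/bigmax_leP; split => //.
by move=> [i j] _ /=; rewrite (ord1 i).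
Qed.

Lemma measurable_box n (A : 'I_n -> set (measurableTypeR R)) : (forall i, measurable (A i)) ->
  measurable [set x : 'rV[R]_n | forall i, A i (x ord0 i)].
Proof.
move=> mA; rewrite (_ : [set _ | _] = \bigcap_(i in [set: 'I_n])
    ((fun x : 'rV[R]_n => x ord0 i) @^-1` A i)).
  apply: fin_bigcap_measurable => // i _; rewrite -[X in measurable X]setTI.
  by apply: measurable_coord => //; exact: mA.
by apply/seteqP; split => [x H i _|x H i] /=; exact: H.
Qed.

(** The sigma-algebra is generated by the coordinates, whereas the topology comes from the sup norm;
    rational boxes form a countable base of the latter and are measurable for the former. *)
Lemma open_measurable_rV n (U : set 'rV[R]_n) : open U -> measurable U.
Proof.
move=> oU.
pose B (p : 'rV[rat]_n * nat) :=
  [set x : 'rV[R]_n | forall i, ball (ratr (p.1 ord0 i) : R) p.2.+1%:R^-1 (x ord0 i)].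
(* Boxes that leave [U] are replaced by the empty set, so that the union ranges over a whole
   countable type. *)
have -> : U = \bigcup_p (if `[< B p `<=` U >] then B p else set0).
  apply/seteqP; split => [x Ux|x [p _]]; last by case: asboolP => // + Bx; exact.
  have /nbhs_ballP[e /= e0 eU] := open_nbhs_nbhs (conj oU Ux).
  (* With each coordinate of the centre within 1/(k+1) of that of x, the box contains x, and its
     points lie within 2/(k+1) < e of x. *)
  have [k ke] : exists k, (0 : R) + k.+1%:R^-1 < e / 2.
    by apply: ltr_add_invr; rewrite divr_gt0.
  rewrite add0r in ke.
  have k0 : 0 < k.+1%:R^-1 :> R by rewrite invr_gt0 ltr0n.
  have /choice[q xq] : forall i, exists q : rat, ball (ratr q : R) k.+1%:R^-1 (x ord0 i).
    move=> i; have [|q] := @rat_in_itvoo _ (x ord0 i - k.+1%:R^-1) (x ord0 i).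
      by rewrite ltrBlDr ltrDl.
    rewrite in_itv/= => /andP[q1 q2]; exists q; move: k0 q1 q2.
    move: (ratr q : R) (x ord0 i) (k.+1%:R^-1 : R) => a b c.
    by move=> c0 h1 h2; rewrite /ball/= ltr_distl; lra.
  exists (\row_i q i, k) => //; rewrite asboolT => [i|y By]/=.
    by rewrite mxE; exact: xq.
  apply: eU; split => // j i; rewrite (ord1 j).
  have := By i; have := xq i; rewrite /= mxE /ball/= => h1 h2.
  rewrite (le_lt_trans (ler_distD (ratr (q i)) _ _))// [X in X + _]distrC.
  by rewrite [ltRHS]splitr ltrD// (lt_trans _ ke).
apply: countable_bigcupT_measurable => // -[p k]; case: asboolP => // _.
apply: (measurable_box (A := fun i => ball (ratr (p ord0 i) : R) k.+1%:R^-1)).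
by move=> i; exact: measurable_ball.
Qed.

Lemma continuous_measurable_rV n (f : 'rV[R]_n -> R) :
  continuous f -> measurable_fun [set: 'rV[R]_n] f.
Proof.
move=> cf; apply: (measurability (@RGenOpens.G R)).
  exact: RGenOpens.measurableE.
move=> _ [_ [a [b ->] <-]]; rewrite setTI; apply: open_measurable_rV.
by move/continuousP : cf; apply; exact: interval_open.
Qed.

Definition bounded_support n (f : 'rV[R]_n -> R) :=
  exists M : R, forall x, M < `|x| -> f x = 0.

Lemma bounded_support_bounded n (f : 'rV[R]_n -> R) :
  continuous f -> bounded_support f -> exists M : R, forall x, `|f x| <= M.
Proof.
move=> cf [M fM].
have : compact (closed_ball (0 : 'rV[R]_n) (`|M| + 1)).
  apply: bounded_closed_compact; last exact: closed_ball_closed.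
  exists (`|M| + 1); split => // y My x; rewrite closed_ballE// /closed_ball_/=.
  by rewrite sub0r normrN => /le_trans; apply; exact: ltW.
move=> /(continuous_compact (continuous_subspaceT cf)) /compact_bounded[B [_ fB]].
exists (`|B| + 1) => x; have [xM|xM] := ltP M `|x|.
  by rewrite fM// normr0 addr_ge0.
apply: fB; first by rewrite (le_lt_trans (ler_norm _))// ltrDl.
exists x => //; rewrite closed_ballE// /closed_ball_/= sub0r normrN.
by rewrite (le_trans xM)// (le_trans (ler_norm _))// lerDl.
Qed.

(** A bounded measurable function is integrable on a set of finite measure, here a cube outside
    which f vanishes; [lebesgue_rV_box] gives the measure of the cube. *)
Lemma integrable_bounded_support n (f : 'rV[R]_n -> R) :
  continuous f -> bounded_support f ->
  (lebesgue_rV n).-integrable [set: 'rV[R]_n] (EFin \o f).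
Proof.
move=> cf sf; have [B fB] := bounded_support_bounded cf sf.
have [M fM] := sf.
pose K := [set x : 'rV[R]_n | forall i, `[- `|M|, `|M|]%classic (x ord0 i)].
have mK : measurable K by apply: (measurable_box (A := fun=> `[- `|M|, `|M|]%classic)).
have fK : (EFin \o f) \_ K = EFin \o f.
  apply/funext => x; rewrite patchE; case: ifPn => //; rewrite notin_setE => Kx.
  rewrite /= fM// ltNge; apply: contra_notN Kx => xM i /=.
  by rewrite in_itv/= -ler_norml (le_trans (ler_coord_norm _ _))// (le_trans xM)// ler_norm.
rewrite -fK; apply/(integrable_mkcond (D := K)) => //.
apply: measurable_bounded_integrable => //.
- have KE : lebesgue_rV n K = _ := lebesgue_rV_box (fun=> measurable_itv `[- `|M|, `|M|]).
  have : (\prod_(i < n) lebesgue_measure `[(- `|M|)%R, `|M|%R]%classic < +oo)%E.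
    rewrite ltey_eq; apply/orP; left; apply: prode_fin_num => i _.
    by rewrite lebesgue_measure_itv/=; case: ifP.
  by rewrite -KE.
- by apply: measurable_funTS; exact: continuous_measurable_rV.
- exists B; split; first exact: num_real.
  by move=> y By x _ /=; exact: le_trans (fB x) (ltW By).
Qed.

(** * Vanishing integrals of derivatives *)

Lemma bounded_support_derive (V : normedModType R) (u : V -> R) (M : R) v :
  (forall x, M < `|x| -> u x = 0) -> forall x, M < `|x| -> 'D_v u x = 0.
Proof.
move=> uM x Mx; rewrite -[RHS](derive_cst (0 : R) x v); apply: near_eq_derive.
have : \forall y \near x, M < `|y| by exact: (cvgr_gt _ (@norm_continuous _ _ x)).
by apply: filterS => y; exact: uM.
Qed.

Lemma integral_derive_eq0 (g : R -> R) (M : R) :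
  (forall x, derivable g x 1) -> continuous ('D_1 g) ->
  (forall x, M < `|x| -> g x = 0) ->
  (\int[lebesgue_measure]_x ('D_1 g x)%:E = 0)%E.
Proof.
(* N is positive and strictly above M, so g vanishes at both endpoints of [-N, N] and its derivative
   vanishes outside this interval. *)
move=> dg cg gM; pose N := `|M| + 1.
have MN : M < N by rewrite (le_lt_trans (ler_norm _))// ltrDl.
have N0 : 0 < N by rewrite ltr_pwDr.
transitivity (\int[lebesgue_measure]_(x in `[(- N)%R, N]) ('D_1 g x)%:E)%E.
  rewrite [RHS]integral_mkcond; apply: eq_integral => x _; rewrite patchE.
  case: ifPn => //; rewrite notin_setE/= in_itv/= -ler_norml => /negP.
  by rewrite -ltNge => /(lt_trans MN) xM; rewrite (@bounded_support_derive R^o g M 1 gM).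
have cg' : continuous g.
  by move=> x; exact/differentiable_continuous/derivable1_diffP.
rewrite (continuous_FTC2 (F := g)).
- by rewrite !gM ?normrN ?gtr0_norm// subee.
- by rewrite gtrN.
- exact: continuous_subspaceT.
- split=> [x _||]; first exact: dg.
  + by apply: cvg_at_right_filter; exact: cg'.
  + by apply: cvg_at_left_filter; exact: cg'.
- by move=> x _; rewrite derive1E.
Qed.

Lemma ball_cons_rV n (a b : R) (x y : 'rV[R]_n) e :
  ball a e b -> ball x e y -> ball (cons_rV (a, x)) e (cons_rV (b, y)).
Proof.
by move=> ab [e0 xy]; split => // i j; rewrite !mxE; case: unliftP => [k|] _ /=.
Qed.

Lemma continuous_cons_rVl n (x : 'rV[R]_n) : continuous (fun a : R => cons_rV (a, x)).
Proof.
move=> a U /nbhs_ballP[e/= e0 eU]; apply/nbhs_ballP; exists e => // b ab.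
by apply: eU; apply: ball_cons_rV => //; exact: ballxx.
Qed.

Lemma continuous_cons_rVr n (a : R) : continuous (fun x : 'rV[R]_n => cons_rV (a, x)).
Proof.
move=> x U /nbhs_ballP[e/= e0 eU]; apply/nbhs_ballP; exists e => // y xy.
by apply: eU; apply: ball_cons_rV => //; exact: ballxx.
Qed.

(** Moving along a basis vector moves either the first coordinate or the remaining ones; [h *: 1] is
    the increment that occurs in a derivative in direction 1. *)
Lemma cons_rV_shiftl n (a h : R) (x : 'rV[R]_n) :
  h *: delta_mx ord0 ord0 + cons_rV (a, x) = cons_rV (h *: 1 + a, x).
Proof.
apply/rowP => i; rewrite !mxE; case: unliftP => [j|] -> /=.
  by rewrite mulr0 add0r.
by rewrite [_%:A]mulr1 mulr1.
Qed.

Lemma cons_rV_shiftr n (a h : R) (x : 'rV[R]_n) j :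
  h *: delta_mx ord0 (lift ord0 j) + cons_rV (a, x) =
  cons_rV (a, h *: delta_mx ord0 j + x).
Proof.
apply/rowP => i; rewrite !mxE; case: unliftP => [k|] -> /=.
  by rewrite !mxE (inj_eq lift_inj).
by rewrite mulr0 add0r.
Qed.

(** Induction on the dimension by Fubini: the inner integral is taken over the block of variables
    containing the j-th one, and it already vanishes, by the induction hypothesis or by the
    fundamental theorem of calculus. *)
Lemma integral_partial_eq0 n (u : 'rV[R]_n -> R) j :
  continuous u -> bounded_support u ->
  (forall x, derivable u x (delta_mx ord0 j)) ->
  continuous ('D_(delta_mx ord0 j) u) ->
  (\int[lebesgue_rV n]_x ('D_(delta_mx ord0 j) u x)%:E = 0)%E.
Proof.
elim: n u j => [u []//|n IH u j cu [M uM] du cdu].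
have iu : (lebesgue_rV n.+1).-integrable [set: 'rV[R]_n.+1] (EFin \o 'D_(delta_mx ord0 j) u).
  by apply: integrable_bounded_support => //; exists M; exact: bounded_support_derive.
have mu : measurable_fun [set: 'rV[R]_n.+1] (EFin \o 'D_(delta_mx ord0 j) u).
  by apply/measurable_EFinP; exact: continuous_measurable_rV.
have iup : (lebesgue_measure \x lebesgue_rV n)%E.-integrable setT
    ((EFin \o 'D_(delta_mx ord0 j) u) \o @cons_rV R n).
  move/integrableP : iu => [_ iu]; apply/integrableP; split.
    by apply: measurableT_comp => //; exact: measurable_cons_rV.
  apply: le_lt_trans iu.
  rewrite [leRHS](@ge0_integral_pushforward _ _ _ _ _ _ (@measurable_cons_rV R n))//.
  exact: measurableT_comp.
transitivity (\int[(lebesgue_measure \x lebesgue_rV n)%E]_p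
    ('D_(delta_mx ord0 j) u (cons_rV p))%:E)%E.
  exact: (integral_pushforward (@measurable_cons_rV R n) mu iup measurableT).
case: (unliftP ord0 j) => [k|] jE.
- rewrite -(integral12_prod_meas1 iup).
  apply: integral0_eq => a _; rewrite /fubini_F/=.
  (* The difference quotients of u and of its slice agree as functions of h, so both derivability
     and the value of the derivative carry over. *)
  have qE x : (fun h => h^-1 *: ((u \o shift (cons_rV (a, x))) (h *: delta_mx ord0 j) -
        u (cons_rV (a, x)))) =
      (fun h => h^-1 *: (((fun x => u (cons_rV (a, x))) \o shift x)
        (h *: delta_mx ord0 k) - u (cons_rV (a, x)))).
    by apply/funext => h; rewrite /= jE cons_rV_shiftr.
  have dE x : 'D_(delta_mx ord0 j) u (cons_rV (a, x)) =
              'D_(delta_mx ord0 k) (fun x => u (cons_rV (a, x))) x.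
    by rewrite /derive qE.
  under eq_integral do rewrite dE.
  apply: IH.
  + by move=> x; apply: continuous_comp; [exact: continuous_cons_rVr|exact: cu].
  + exists M => x Mx; apply: uM; rewrite (lt_le_trans Mx)//.
    apply: norm_ler_coord => // i.
    have := ler_coord_norm (cons_rV (a, x)) (lift ord0 i).
    by rewrite mxE liftK.
  + move=> x; have := du (cons_rV (a, x)).
    by rewrite /derivable qE.
  + rewrite -(funext dE) => x.
    apply: (@continuous_comp _ _ _ (fun x : 'rV[R]_n => cons_rV (a, x))
      ('D_(delta_mx ord0 j) u)); first exact: continuous_cons_rVr.
    exact: cdu.
- rewrite -(integral21_prod_meas1 iup).
  apply: integral0_eq => x _; rewrite /fubini_G/=.
  have qE a : (fun h => h^-1 *: ((u \o shift (cons_rV (a, x))) (h *: delta_mx ord0 j) -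
        u (cons_rV (a, x)))) =
      (fun h => h^-1 *: (((fun a => u (cons_rV (a, x))) \o shift a) (h *: 1) -
        u (cons_rV (a, x)))).
    by apply/funext => h; rewrite /= jE cons_rV_shiftl.
  have dE a : 'D_(delta_mx ord0 j) u (cons_rV (a, x)) =
              'D_1 (fun a => u (cons_rV (a, x))) a.
    by rewrite /derive qE.
  under eq_integral do rewrite dE.
  apply: (@integral_derive_eq0 _ M).
  + move=> a; have := du (cons_rV (a, x)).
    by rewrite /derivable qE.
  + rewrite -(funext dE) => a.
    apply: (@continuous_comp _ _ _ (fun a : R => cons_rV (a, x))
      ('D_(delta_mx ord0 j) u)); first exact: continuous_cons_rVl.
    exact: cdu.
  + move=> a Ma; apply: uM; rewrite (lt_le_trans Ma)//.
    have := ler_coord_norm (cons_rV (a, x)) ord0.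
    by rewrite mxE unlift_none.
Qed.

End measure_rV.

(** * Partial derivatives of smooth functions *)

Section smooth_functions.
Context {R : realType} {n : nat}.
Implicit Types (u v : 'rV[R]_n -> R) (x y a b : 'rV[R]_n).

Lemma is_derive_line u y a (s : R) :
  derivable u (s *: a + y) a ->
  is_derive s 1 (fun t : R => u (t *: a + y)) ('D_a u (s *: a + y)).
Proof.
have E : (fun h => h^-1 *: (((fun t : R => u (t *: a + y)) \o shift s) (h *: 1) -
      u (s *: a + y))) =
    (fun h => h^-1 *: ((u \o shift (s *: a + y)) (h *: a) - u (s *: a + y))).
  by apply/funext => h; rewrite /= [_%:A]mulr1 scalerDl addrA.
by move=> du; apply: DeriveDef; [rewrite /derivable E|rewrite /derive E].
Qed.

(** The mean value theorem is applied twice: to the b-increment of u as a function of the step along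
    a, then to the a-derivative along b. *)
Lemma second_difference u a b x (h : R) :
  (forall y, derivable u y a) -> (forall y, derivable ('D_a u) y b) -> 0 < h ->
  exists s t : R, [/\ s \in `[0, h], t \in `[0, h] &
    u (h *: a + (h *: b + x)) - u (h *: a + x) - (u (h *: b + x) - u x) =
    'D_b ('D_a u) (t *: b + (s *: a + x)) * h * h].
Proof.
move=> du ddu h0.
pose p (s : R) := u (s *: a + (h *: b + x)) - u (s *: a + x).
have dp (s : R) : is_derive s 1 p ('D_a u (s *: a + (h *: b + x)) - 'D_a u (s *: a + x)).
  by apply: is_deriveB; exact: is_derive_line.
have cp : continuous p.
  by move=> s; apply/differentiable_continuous/derivable1_diffP; exact: ex_derive.
have [s sh ps] := @MVT_segment _ p _ 0 h (ltW h0) (fun s _ => dp s) (continuous_subspaceT cp).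
pose q (t : R) := 'D_a u (t *: b + (s *: a + x)).
have dq (t : R) : is_derive t 1 q ('D_b ('D_a u) (t *: b + (s *: a + x))).
  exact: is_derive_line.
have cq : continuous q.
  by move=> t; apply/differentiable_continuous/derivable1_diffP; exact: ex_derive.
have [t th qt] := @MVT_segment _ q _ 0 h (ltW h0) (fun t _ => dq t) (continuous_subspaceT cq).
exists s, t; split => //.
move: ps qt; rewrite /p /q !subr0 !scale0r !add0r => -> <-.
by rewrite (addrCA (s *: a)).
Qed.

(** The second difference over a small parallelogram is symmetric in a and b, so it equals h^2 times
    a value of either mixed derivative near x; continuity at x concludes. *)
Lemma derive_swap u a b :
  (forall y, derivable u y a) -> (forall y, derivable u y b) ->
  (forall y, derivable ('D_a u) y b) -> (forall y, derivable ('D_b u) y a) ->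
  continuous ('D_b ('D_a u)) -> continuous ('D_a ('D_b u)) ->
  'D_b ('D_a u) = 'D_a ('D_b u).
Proof.
move=> dua dub duab duba cab cba; apply/funext => x; apply/eqP/negP => /negP neq.
(* Half of the supposed gap: two errors below e cannot fill it. *)
pose e : R := `|'D_b ('D_a u) x - 'D_a ('D_b u) x| / 2.
have e0 : 0 < e by rewrite divr_gt0// normr_gt0 subr_eq0.
have [r r0 ar] : exists2 r : R, 0 < r & forall y, `|x - y| < r ->
    `|'D_b ('D_a u) x - 'D_b ('D_a u) y| < e /\
    `|'D_a ('D_b u) x - 'D_a ('D_b u) y| < e.
  have /cvgrPdist_lt /(_ e e0) near1 := cab x.
  have /cvgrPdist_lt /(_ e e0) near2 := cba x.
  have /nbhs_ballP[r /= r0] : \forall y \near x,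
      `|'D_b ('D_a u) x - 'D_b ('D_a u) y| < e /\
      `|'D_a ('D_b u) x - 'D_a ('D_b u) y| < e by exact: filterI near1 near2.
  by rewrite -ball_normE => xr; exists r => // y /xr[].
(* The added 1 makes N positive and strictly above |a| + |b|; with h = r / (2 N) every point of the
   parallelogram is within r / 2 of x. *)
pose N : R := `|a| + `|b| + 1.
have N0 : 0 < N by rewrite ltr_wpDl// addr_ge0.
pose h : R := r / (N * 2).
have h0 : 0 < h by rewrite divr_gt0// mulr_gt0.
have small c d s t : `|c| + `|d| < N -> s \in `[0, h] -> t \in `[0, h] ->
    `|x - (t *: d + (s *: c + x))| < r.
  rewrite !in_itv/= => cd /andP[s0 sh] /andP[t0 th].
  rewrite addrA opprD addrCA subrr addr0 normrN (le_lt_trans (ler_normD _ _))//.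
  rewrite !normrZ !ger0_norm//.
  have : t * `|d| + s * `|c| <= h * N.
    rewrite (le_trans (lerD (ler_wpM2r _ th) (ler_wpM2r _ sh)))// -mulrDr.
    by rewrite ler_wpM2l ?(ltW h0)// addrC ltW.
  move=> /le_lt_trans; apply; rewrite /h invfM mulrA mulrAC divfK ?gt_eqF//.
  by rewrite gtr_pMr// invf_lt1// ltr1n.
have [s [t [sh th E1]]] := second_difference x dua duab h0.
have [s' [t' [sh' th' E2]]] := second_difference x dub duba h0.
have E : 'D_b ('D_a u) (t *: b + (s *: a + x)) = 'D_a ('D_b u) (t' *: a + (s' *: b + x)).
  apply: (mulIf (lt0r_neq0 h0)); apply: (mulIf (lt0r_neq0 h0)).
  apply: etrans (esym E1) (etrans _ E2).
  have -> : h *: a + (h *: b + x) = h *: b + (h *: a + x) by rewrite addrCA.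
  move: (u (h *: b + (h *: a + x))) (u (h *: a + x)) (u (h *: b + x)) (u x).
  by move=> A B C D; ring.
have [h1 _] := ar _ (small a b s t ltac:(by rewrite ltrDl) sh th).
have [_ h2] := ar _ (small b a s' t' ltac:(by rewrite addrC ltrDl) sh' th').
rewrite -E in h2.
have := ler_distD ('D_b ('D_a u) (t *: b + (s *: a + x))) ('D_b ('D_a u) x) ('D_a ('D_b u) x).
rewrite [X in _ <= _ + X]distrC => /le_lt_trans /(_ (ltrD h1 h2)).
by rewrite /e -splitr ltxx.
Qed.

(** * Functions of class C^k and the derivatives of x_j and 1/|x| *)

Local Notation e j := (delta_mx ord0 j : 'rV[R]_n).

Definition rpartial j u : 'rV[R]_n -> R := 'D_(e j) u.

Definition vanishes_near0 u := exists2 d : R, 0 < d & forall x, `|x| < d -> u x = 0.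

(** Continuity is required at every level, since derivability along the coordinate directions alone
    does not imply it. *)
Fixpoint Ck k u := continuous u /\
  if k is k'.+1 then forall j, (forall x, derivable u x (e j)) /\ Ck k' (rpartial j u)
  else True.

Lemma Ck_continuous k u : Ck k u -> continuous u.
Proof. by case: k => [|k] []. Qed.

Lemma Ck_derivable k u j x : Ck k.+1 u -> derivable u x (e j).
Proof. by move=> [_ /(_ j)[]]. Qed.

Lemma Ck_partial k u j : Ck k.+1 u -> Ck k (rpartial j u).
Proof. by move=> [_ /(_ j)[]]. Qed.

Lemma Ck_weaken k u : Ck k.+1 u -> Ck k u.
Proof.
elim: k u => [|k IH] u [cu du]; split => // j; split; first exact: (du j).1.
exact: IH (du j).2.
Qed.

Lemma partialD u v j : (forall x, derivable u x (e j)) ->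
  (forall x, derivable v x (e j)) -> rpartial j (u + v) = rpartial j u + rpartial j v.
Proof. by move=> du dv; apply/funext => x; rewrite /rpartial deriveD. Qed.

Lemma partialM u v j : (forall x, derivable u x (e j)) ->
  (forall x, derivable v x (e j)) -> rpartial j (u * v) = u * rpartial j v + v * rpartial j u.
Proof. by move=> du dv; apply/funext => x; rewrite /rpartial deriveM. Qed.

Lemma partial_cst (c : R) j : rpartial j (cst c) = 0.
Proof. by apply/funext => x; rewrite /rpartial derive_cst. Qed.

Arguments Ck_derivable {k u} j x _.
Lemma CkD k u v : Ck k u -> Ck k v -> Ck k (u + v).
Proof.
elim: k u v => [|k IH] u v [cu du] [cv dv]; split => //;
  try by move=> x; apply: continuousD; [exact: cu|exact: cv].
move=> j; have [du1 du2] := du j; have [dv1 dv2] := dv j; split.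
  by move=> x; exact: derivableD.
by rewrite partialD//; exact: IH.
Qed.

Lemma CkM k u v : Ck k u -> Ck k v -> Ck k (u * v).
Proof.
elim: k u v => [|k IH] u v Cu Cv; split => //;
  try by move=> x; apply: continuousM; [exact: (Ck_continuous Cu)|exact: (Ck_continuous Cv)].
move=> j; split.
  by move=> x; exact: (derivableM (Ck_derivable j x Cu) (Ck_derivable j x Cv)).
rewrite partialM => [|x|x]; [|exact: (Ck_derivable j x Cu)|exact: (Ck_derivable j x Cv)].
by apply: CkD; apply: IH;
  [exact: Ck_weaken|exact: (Ck_partial j Cv)|exact: Ck_weaken|exact: (Ck_partial j Cu)].
Qed.

Lemma Ck_cst k (c : R) : Ck k (cst c).
Proof.
elim: k c => [|k IH] c; split => //; try exact: cst_continuous.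
by move=> j; split; [move=> x; exact: derivable_cst|rewrite partial_cst; exact: IH].
Qed.

Definition xcoord j : 'rV[R]_n -> R := fun x => x ord0 j.

Lemma is_derive_xcoord i j x : is_derive x (e i) (xcoord j) (j == i)%:R.
Proof.
(* The coordinate is linear, so its difference quotient is constant away from h = 0. *)
have E : \forall h \near (0 : R)^',
    h^-1 *: ((xcoord j \o shift x) (h *: e i) - xcoord j x) = (j == i)%:R.
  near=> h; have h0 : h != 0 by near: h; exact: nbhs_dnbhs_neq.
  rewrite /xcoord/= !mxE addrK eqxx/= scalerA mulVf ?scale1r//.
have cE : (fun h => h^-1 *: ((xcoord j \o shift x) (h *: e i) - xcoord j x)) @
    (0 : R)^' --> ((j == i)%:R : R).
  apply: cvg_near_cst; exact: E.
apply: DeriveDef; first by apply/cvg_ex; exists (j == i)%:R.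
exact: cvg_lim cE.
Unshelve. all: by end_near. Qed.

Lemma partial_xcoord i j : rpartial i (xcoord j) = cst (j == i)%:R.
Proof.
apply/funext => x.
by rewrite /rpartial (@derive_val _ _ _ _ _ _ _ (is_derive_xcoord i j x)).
Qed.

Lemma Ck_xcoord k j : Ck k (xcoord j).
Proof.
case: k => [|k]; split => //; try exact: coord_continuous.
move=> i; split; first by move=> x; have [] := is_derive_xcoord i j x.
by rewrite partial_xcoord; exact: Ck_cst.
Qed.

(* 1/|x|, with the junk value 0 at the origin. *)
Definition normV : 'rV[R]_n -> R := fun x => (enorm x)^-1.

Lemma sumsq_gt0 x : x != 0 -> 0 < \sum_j x ord0 j ^+ 2.
Proof.
move=> x0; rewrite lt_neqAle sumr_ge0 ?andbT => [|j _]; last exact: sqr_ge0.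
apply: contra_neq x0 => /esym/eqP; rewrite psumr_eq0 => [/allP s0|j _]; last exact: sqr_ge0.
apply/rowP => j; rewrite mxE; apply/eqP; rewrite -sqrf_eq0.
exact: (s0 j (mem_index_enum j)).
Qed.

Lemma enorm_gt0 x : x != 0 -> 0 < enorm x.
Proof. by move=> x0; rewrite sqrtr_gt0 sumsq_gt0. Qed.

Lemma normV_sumsq x : x != 0 -> normV x ^+ 2 * \sum_j x ord0 j ^+ 2 = 1.
Proof.
move=> x0; rewrite /normV exprVn sqr_sqrtr ?(ltW (sumsq_gt0 x0))// mulVf//.
by rewrite gt_eqF// sumsq_gt0.
Qed.

Lemma normV_continuous x : x != 0 -> {for x, continuous normV}.
Proof.
move=> x0; apply: continuousV; first by rewrite gt_eqF// enorm_gt0.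
apply: continuous_comp; last exact: sqrt_continuous.
rewrite (_ : (fun x : 'rV[R]_n => \sum_j x ord0 j ^+ 2) = \sum_j (xcoord j * xcoord j)).
  apply: (@Ck_continuous 0); elim/big_ind: _ => [|u v|j _]; first exact: (Ck_cst 0 0).
    exact: CkD.
  by apply: CkM; exact: Ck_xcoord.
by apply/funext => y; rewrite fct_sumE.
Qed.

(** Restricted to the line through x in direction e_j, |x|^2 becomes a function [q] of one real
    variable, to which the rules for square root and inverse apply because [q 0] is positive. *)
Lemma is_derive_normV j x : x != 0 ->
  is_derive x (e j) normV (- (x ord0 j * normV x ^+ 3)).
Proof.
move=> x0; pose S := \sum_i (xcoord i * xcoord i).
have dS : is_derive x (e j) S (\sum_i (xcoord i x * (i == j)%:R + xcoord i x * (i == j)%:R)).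
  by apply: is_derive_sum => i; apply: is_deriveM; exact: is_derive_xcoord.
have SE : \sum_i (xcoord i x * (i == j)%:R + xcoord i x * (i == j)%:R) = 2 * x ord0 j.
  rewrite (bigD1 j)//= eqxx big1 => [|i /negPf ->]; last by rewrite !mulr0 addr0.
  by rewrite addr0 /xcoord !mulr1; ring.
rewrite SE in dS.
pose q := fun h : R => S (h *: e j + x).
have dq : is_derive (0 : R) 1 q (2 * x ord0 j).
  have dS' : derivable S (0 *: e j + x) (e j) by rewrite scale0r add0r; have [] := dS.
  have := is_derive_line dS'; rewrite scale0r add0r.
  by rewrite (@derive_val _ _ _ _ _ _ _ dS).
have q0 : q 0 = \sum_i x ord0 i ^+ 2 by rewrite /q scale0r add0r /S fct_sumE.
have dsq : is_derive (q 0) 1 Num.sqrt (2 * Num.sqrt (q 0))^-1.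
  by apply: is_derive1_sqrt; rewrite q0 sumsq_gt0.
have dr : is_derive (0 : R) 1 (Num.sqrt \o q) ((2 * Num.sqrt (q 0))^-1 * (2 * x ord0 j)).
  exact: is_derive1_comp.
have r0 : (Num.sqrt \o q) 0 != 0 by rewrite /= q0 gt_eqF// enorm_gt0.
have dw := is_deriveV r0 dr.
have wE : (fun h : R => normV (h *: e j + x)) = (fun h => ((Num.sqrt \o q) h)^-1).
  by apply/funext => h; rewrite /normV /= /q /S fct_sumE.
have dw' : is_derive (0 : R) 1 (fun h : R => normV (h *: e j + x))
    (- (x ord0 j * normV x ^+ 3)).
  rewrite wE; apply: is_derive_eq.
  rewrite /= q0 /normV /enorm.
  move: (enorm_gt0 x0); rewrite /enorm; move: (Num.sqrt _) => r r_gt0.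
  have : r != 0 by rewrite gt_eqF.
  by move=> ?; rewrite /GRing.scale/=; field.
have E : (fun h => h^-1 *: ((normV \o shift x) (h *: e j) - normV x)) =
    (fun h => h^-1 *: (((fun h : R => normV (h *: e j + x)) \o shift 0) (h *: 1) -
       normV (0 *: e j + x))).
  by apply/funext => h; rewrite /= addr0 scale0r add0r [_%:A]mulr1.
have [d1 d2] := dw'.
apply: DeriveDef; first by rewrite /derivable E.
by rewrite /derive E.
Qed.

End smooth_functions.
Arguments Ck_derivable {R n k u} j x _.

(** * Radial and spherical derivatives *)

Section good_functions.
Context {R : realType} {n : nat}.
Implicit Types (u v : 'rV[R]_n -> R) (x y : 'rV[R]_n).

Lemma vanishes_near0P u : vanishes_near0 u -> \forall x \near (0 : 'rV[R]_n), u x = 0.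
Proof.
move=> [d d0 ud]; apply/nbhs_ballP; exists d => // x.
by rewrite -ball_normE /= sub0r normrN; exact: ud.
Qed.

Lemma vanishes_at0 u : vanishes_near0 u -> u 0 = 0.
Proof. by move=> [d d0]; apply; rewrite normr0. Qed.

Lemma vanishes_partial u j : vanishes_near0 u -> vanishes_near0 (rpartial j u).
Proof.
move=> [d d0 ud]; exists d => // x xd.
rewrite /rpartial -[RHS](derive_cst (0 : R) x (delta_mx ord0 j)); apply: near_eq_derive.
have : \forall y \near x, `|y| < d by exact: (cvgr_lt _ (@norm_continuous _ _ x)).
by apply: filterS => y; exact: ud.
Qed.

Lemma vanishesD u v : vanishes_near0 u -> vanishes_near0 v -> vanishes_near0 (u + v).
Proof.
move=> [d d0 ud] [d' d'0 vd]; exists (Num.min d d'); first by rewrite lt_min d0.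
by move=> x; rewrite lt_min => /andP[xd xd']; rewrite fctE ud// vd// addr0.
Qed.

Lemma vanishesM u v : vanishes_near0 u -> vanishes_near0 (v * u).
Proof. by move=> [d d0 ud]; exists d => // x xd; rewrite fctE ud// mulr0. Qed.

Lemma CkN k u : Ck k u -> Ck k (- u).
Proof.
move=> Cu; rewrite (_ : - u = cst (-1) * u); first exact: CkM (Ck_cst k (-1)) Cu.
by apply/funext => x; rewrite !fctE mulN1r.
Qed.

(** Off the origin this is the product rule; at the origin both sides are 0 because u vanishes
    nearby. The cube of [normV] is written as nested products so that each [normV] multiplies a
    function vanishing near 0. *)
Lemma partial_normVM u j : (forall x, derivable u x (delta_mx ord0 j)) ->
  vanishes_near0 u ->
  (forall x, derivable (normV * u) x (delta_mx ord0 j)) /\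
  rpartial j (normV * u) =
    normV * rpartial j u - xcoord j * (normV * (normV * (normV * u))).
Proof.
move=> du u0.
have near0 : \forall x \near (0 : 'rV[R]_n), (normV * u) x = cst 0 x.
  by apply: filterS (vanishes_near0P u0) => x ux; rewrite !fctE ux mulr0.
split=> [x|].
  have [->|x0] := eqVneq x 0.
    apply: near_eq_derivable (derivable_cst (0 : R) 0 (delta_mx ord0 j)).
    by apply: filterS near0 => y ->.
  by apply: derivableM => //; have [] := is_derive_normV j x0.
apply/funext => x; rewrite !fctE /rpartial.
have [->|x0] := eqVneq x 0.
  rewrite (near_eq_derive _ near0) derive_cst (vanishes_at0 u0) !mulr0 subr0.
  by have := vanishes_at0 (vanishes_partial j u0); rewrite /rpartial => ->; rewrite mulr0.
have dw := is_derive_normV j x0.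
rewrite deriveM//.
rewrite (@derive_val _ _ _ _ _ _ _ dw) /xcoord /GRing.scale/=; ring.
Qed.

(** Continuity at the origin holds because the product is locally 0. The derivative consists of
    iterated multiples by [normV] of functions vanishing near 0, so the induction hypothesis applies
    to it, three times in a row for the last term. *)
Lemma Ck_normVM k u : Ck k u -> vanishes_near0 u -> Ck k (normV * u).
Proof.
elim: k u => [|k IH] u Cu u0.
  split => // x; have cu := Ck_continuous Cu.
  have [->|x0] := eqVneq x 0; last by apply: continuousM; [exact: normV_continuous|exact: cu].
  move=> A /nbhs_singleton; rewrite !fctE (vanishes_at0 u0) mulr0 => A0.
  by have := vanishes_near0P u0; apply: filterS => y uy /=; rewrite uy mulr0.
have dw j := partial_normVM (fun x => Ck_derivable j x Cu) u0.
split; first by apply: Ck_continuous (IH _ (Ck_weaken Cu) u0).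
move=> j; have [d1 ->] := dw j; split=> //.
apply: CkD; first by apply: IH; [exact: Ck_partial j Cu|exact: vanishes_partial].
apply: CkN; apply: CkM; first exact: Ck_xcoord.
have v1 := vanishesM normV u0; have v2 := vanishesM normV v1.
exact: IH _ (IH _ (IH _ (Ck_weaken Cu) u0) v1) v2.
Qed.

(** The real-valued counterpart of [test_function]. Pointwise vanishing near 0 and far away replaces
    the condition on the closed support, as it passes at once to products and derivatives. *)
Definition good u := [/\ forall k, Ck k u, vanishes_near0 u & bounded_support u].

Lemma good_derivable u j x : good u -> derivable u x (delta_mx ord0 j).
Proof. by move=> [Cu _ _]; exact: (Ck_derivable j x (Cu 1%N)). Qed.

Lemma good_continuous u : good u -> continuous u.
Proof. by move=> [Cu _ _]; exact: Ck_continuous (Cu 0%N). Qed.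

Lemma goodMl u v : good u -> (forall k, Ck k v) -> good (v * u).
Proof.
move=> [Cu u0 [M uM]] Cv; split; first by move=> k; exact: CkM.
  exact: vanishesM.
by exists M => x xM; rewrite fctE uM// mulr0.
Qed.

Lemma goodM u v : good u -> good v -> good (u * v).
Proof. by move=> [Cu _ _] gv; exact: goodMl. Qed.

Lemma good_cst (c : R) u : good u -> good (cst c * u).
Proof. by move=> gu; apply: goodMl => // k; exact: Ck_cst. Qed.

Lemma good_xcoord j u : good u -> good (xcoord j * u).
Proof. by move=> gu; apply: goodMl => // k; exact: Ck_xcoord. Qed.

Lemma good_normV u : good u -> good (normV * u).
Proof.
move=> [Cu u0 [M uM]]; split; first by move=> k; exact: Ck_normVM.
  exact: vanishesM.
by exists M => x xM; rewrite fctE uM// mulr0.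
Qed.

Lemma goodD u v : good u -> good v -> good (u + v).
Proof.
move=> [Cu u0 [M uM]] [Cv v0 [N vN]]; split; first by move=> k; exact: CkD.
  exact: vanishesD.
by exists (Num.max M N) => x; rewrite gt_max => /andP[xM xN]; rewrite fctE uM// vN// addr0.
Qed.

Lemma goodN u : good u -> good (- u).
Proof.
move=> gu; rewrite (_ : - u = cst (-1) * u); first exact: good_cst.
by apply/funext => x; rewrite !fctE mulN1r.
Qed.

Lemma good0 : good 0.
Proof.
split; first by move=> k; exact: Ck_cst.
  by exists 1.
by exists 0.
Qed.

Lemma good_sum (F : 'I_n -> 'rV[R]_n -> R) :
  (forall j, good (F j)) -> good (\sum_j F j).
Proof. by move=> gF; elim/big_ind: _ => //; [exact: good0|exact: goodD]. Qed.

Lemma good_partial u j : good u -> good (rpartial j u).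
Proof.
move=> [Cu u0 [M uM]]; split; first by move=> k; exact: Ck_partial (Cu k.+1).
  exact: vanishes_partial.
by exists M; exact: bounded_support_derive.
Qed.

Lemma good_partialD u v j : good u -> good v ->
  rpartial j (u + v) = rpartial j u + rpartial j v.
Proof. by move=> gu gv; apply: partialD => x; exact: good_derivable. Qed.

Lemma good_partialM u v j : good u -> good v ->
  rpartial j (u * v) = u * rpartial j v + v * rpartial j u.
Proof. by move=> gu gv; apply: partialM => x; exact: good_derivable. Qed.

Lemma good_partial_cst (c : R) u j : good u ->
  rpartial j (cst c * u) = cst c * rpartial j u.
Proof.
move=> gu; rewrite partialM ?partial_cst ?mulr0 ?addr0//.
by move=> x; exact: good_derivable.
Qed.

Lemma good_partial_xcoord u i j : good u ->
  rpartial i (xcoord j * u) = xcoord j * rpartial i u + cst (j == i)%:R * u.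
Proof.
move=> gu; rewrite partialM; first by rewrite partial_xcoord [u * _]mulrC.
  move=> x.
  by have [] := is_derive_xcoord i j x.
by move=> x; exact: good_derivable.
Qed.

Lemma good_partial_normV u j : good u -> rpartial j (normV * u) =
  normV * rpartial j u - xcoord j * (normV * (normV * (normV * u))).
Proof.
by move=> gu; apply: (partial_normVM _ _).2; [move=> x; exact: good_derivable|case: gu].
Qed.

Lemma good_partial_sum (F : 'I_n -> 'rV[R]_n -> R) j :
  (forall k, good (F k)) -> rpartial j (\sum_k F k) = \sum_k rpartial j (F k).
Proof.
move=> gF; apply/funext => x; rewrite /rpartial derive_sum ?fct_sumE// => k.
exact: good_derivable.
Qed.

Lemma good_partial_swap u i j : good u ->
  rpartial i (rpartial j u) = rpartial j (rpartial i u).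
Proof.
move=> gu; have gi := good_partial i gu; have gj := good_partial j gu.
apply: derive_swap; try by move=> y; exact: good_derivable.
  exact: good_continuous (good_partial i gj).
exact: good_continuous (good_partial j gi).
Qed.

(** Off the origin the factor is |x|^2 / |x|^2, and at the origin u is 0. Read from right to left,
    it turns a single term into a sum over j. *)
Lemma normV_cancel u : good u -> normV * (normV * (\sum_j xcoord j * xcoord j * u)) = u.
Proof.
move=> [_ u0 _]; rewrite -mulr_suml; apply/funext => x; rewrite !fctE fct_sumE.
have [->|x0] := eqVneq x 0; first by rewrite (vanishes_at0 u0) !mulr0.
under eq_bigr do rewrite fctE -expr2.
by rewrite !mulrA -expr2 normV_sumsq// mul1r.
Qed.

(** * The derivatives d_r and L_j and their commutation rules *)

Definition Dr u : 'rV[R]_n -> R := \sum_j xcoord j * (normV * rpartial j u).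

Definition Ls j u : 'rV[R]_n -> R := rpartial j u - xcoord j * (normV * Dr u).

Lemma good_Dr u : good u -> good (Dr u).
Proof.
by move=> gu; apply: good_sum => j; apply: good_xcoord; apply: good_normV; exact: good_partial.
Qed.

Lemma good_Ls j u : good u -> good (Ls j u).
Proof.
move=> gu; apply: goodD; first exact: good_partial.
by apply: goodN; apply: good_xcoord; apply: good_normV; exact: good_Dr.
Qed.

Lemma DrD u v : good u -> good v -> Dr (u + v) = Dr u + Dr v.
Proof.
move=> gu gv; rewrite /Dr -big_split/=; apply: eq_bigr => k _.
by rewrite good_partialD//; ring.
Qed.

Lemma DrM u v : good u -> good v -> Dr (u * v) = u * Dr v + v * Dr u.
Proof.
move=> gu gv; rewrite /Dr !mulr_sumr -big_split/=; apply: eq_bigr => k _.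
by rewrite good_partialM//; ring.
Qed.

Lemma Dr_cst (c : R) u : good u -> Dr (cst c * u) = cst c * Dr u.
Proof.
move=> gu; rewrite /Dr mulr_sumr; apply: eq_bigr => k _.
by rewrite good_partial_cst//; ring.
Qed.

Lemma DrN u : good u -> Dr (- u) = - Dr u.
Proof.
move=> gu; have N v : - v = cst (-1) * v by apply/funext => x; rewrite !fctE mulN1r.
by rewrite N Dr_cst// -N.
Qed.

Lemma Dr0 : Dr 0 = 0.
Proof.
by rewrite /Dr big1// => j _; rewrite (partial_cst 0 j : rpartial j 0 = 0) !mulr0.
Qed.

Lemma Dr_sum (F : 'I_n -> 'rV[R]_n -> R) :
  (forall k, good (F k)) -> Dr (\sum_k F k) = \sum_k Dr (F k).
Proof.
move=> gF; rewrite /Dr exchange_big/=; apply: eq_bigr => j _.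
by rewrite good_partial_sum// !mulr_sumr.
Qed.

(** Used from right to left to write a single term as a sum over k, so that identities between sums
    can be checked term by term. *)
Lemma sum_cst_eq (F : 'I_n -> 'rV[R]_n -> R) j :
  \sum_k cst (j == k)%:R * F k = F j.
Proof.
rewrite (bigD1 j)//= big1 => [|k /negPf kj]; last by rewrite eq_sym kj; exact: mul0r.
by rewrite eqxx addr0; exact: mul1r.
Qed.

Lemma Dr_xcoord j u : good u ->
  Dr (xcoord j * u) = xcoord j * Dr u + xcoord j * (normV * u).
Proof.
move=> gu; rewrite /Dr mulr_sumr.
rewrite -[X in _ = _ + X](sum_cst_eq (fun k => xcoord k * (normV * u))).
rewrite -big_split/=; apply: eq_bigr => k _.
by rewrite good_partial_xcoord//; ring.
Qed.

Lemma Dr_normV u : good u -> Dr (normV * u) = normV * Dr u - normV * (normV * u).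
Proof.
move=> gu; rewrite -[X in _ - _ * (_ * X)](normV_cancel gu) /Dr !mulr_sumr -sumrB.
by apply: eq_bigr => k _; rewrite good_partial_normV//; ring.
Qed.

(** The function x_j / |x| is constant along rays. *)
Lemma Dr_xcoord_normV j u : good u ->
  Dr (xcoord j * (normV * u)) = xcoord j * (normV * Dr u).
Proof.
by move=> gu; rewrite Dr_xcoord ?Dr_normV//; [ring|exact: good_normV].
Qed.

Lemma LsD j u v : good u -> good v -> Ls j (u + v) = Ls j u + Ls j v.
Proof. by move=> gu gv; rewrite /Ls good_partialD// DrD//; ring. Qed.

Lemma LsM j u v : good u -> good v -> Ls j (u * v) = u * Ls j v + v * Ls j u.
Proof. by move=> gu gv; rewrite /Ls good_partialM// DrM//; ring. Qed.

Lemma Ls_cst j (c : R) u : good u -> Ls j (cst c * u) = cst c * Ls j u.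
Proof. by move=> gu; rewrite /Ls good_partial_cst// Dr_cst//; ring. Qed.

(** The function 1/|x| is radial, so L_j annihilates it. *)
Lemma Ls_normV j u : good u -> Ls j (normV * u) = normV * Ls j u.
Proof. by move=> gu; rewrite /Ls good_partial_normV// Dr_normV//; ring. Qed.

(** The L_j u are the components of the gradient minus its radial part, a vector orthogonal to x. *)
Lemma sum_xcoord_Ls u : good u -> \sum_j xcoord j * (normV * Ls j u) = 0.
Proof.
move=> gu; have gD := good_Dr gu.
transitivity (Dr u - normV * (normV * \sum_j xcoord j * xcoord j * Dr u)).
  by rewrite {1}/Dr !mulr_sumr -sumrB; apply: eq_bigr => j _; rewrite /Ls; ring.
by rewrite normV_cancel// subrr.
Qed.

Lemma Ls_Dr j u : good u -> Ls j (Dr u) = Dr (Ls j u) + normV * Ls j u.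
Proof.
move=> gu; have gD := good_Dr gu.
have gp k : good (rpartial k u) by exact: good_partial.
(* Differentiating the coefficients x_k / |x| gives the first and last terms, which combine into
   [normV * Ls j u]; the middle one comes from exchanging the partial derivatives. *)
have pD : rpartial j (Dr u) = normV * rpartial j u + Dr (rpartial j u) -
    xcoord j * (normV * (normV * Dr u)).
  rewrite {1}/Dr.
  rewrite good_partial_sum => [|k]; last by apply: good_xcoord; exact: good_normV.
  rewrite -[normV * rpartial j u](sum_cst_eq (fun k => normV * rpartial k u)).
  rewrite /Dr -big_split !mulr_sumr -sumrB/=; apply: eq_bigr => k _.
  rewrite good_partial_xcoord ?good_partial_normV//; last exact: good_normV.
  by rewrite (good_partial_swap j k)// eq_sym; ring.
rewrite {1}/Ls pD.
have -> : Dr (Ls j u) = Dr (rpartial j u) - xcoord j * (normV * Dr (Dr u)).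
  have gw : good (xcoord j * (normV * Dr u)) by apply: good_xcoord; exact: good_normV.
  by rewrite /Ls DrD ?DrN ?Dr_xcoord_normV//; exact: goodN.
by rewrite /Ls; ring.
Qed.

(** The derivatives of the x_j contribute n / |x| and those of 1/|x| contribute -1/|x|, whence n -
    1. *)
Lemma sum_partial_radial u : good u ->
  \sum_j rpartial j (xcoord j * (normV * u)) = Dr u + cst (n%:R - 1) * (normV * u).
Proof.
move=> gu; have gw := good_normV gu.
transitivity (\sum_j (xcoord j * (normV * rpartial j u) -
    normV * (normV * (normV * (xcoord j * xcoord j * u))) + normV * u)).
  apply: eq_bigr => j _; rewrite good_partial_xcoord// good_partial_normV// eqxx.
  by rewrite (mul1r _ : cst 1 * (normV * u) = normV * u); ring.
rewrite big_split sumrB/= -!mulr_sumr normV_cancel// sumr_const card_ord -/(Dr u).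
by apply/funext => x; rewrite natmulfctE !fctE -mulr_natl; ring.
Qed.

(** The difference is the sum of the x_j/|x| d_r (u L_j v). Since x_j/|x| passes inside d_r, this is
    d_r of u times the sum of the x_j/|x| L_j v, which is 0. *)
Lemma sum_Ls_partial u v : good u -> good v ->
  \sum_j Ls j (u * Ls j v) = \sum_j rpartial j (u * Ls j v).
Proof.
move=> gu gv; have gL j := good_Ls j gv; have guL j := goodM gu (gL j).
rewrite /Ls sumrB .
suff -> : \sum_j xcoord j * (normV * Dr (u * Ls j v)) = 0 by rewrite subr0.
under eq_bigr do rewrite -Dr_xcoord_normV//.
rewrite -Dr_sum => [|j]; last by apply: good_xcoord; exact: good_normV.
rewrite (_ : \sum_k _ = u * \sum_j xcoord j * (normV * Ls j v)).
  by rewrite sum_xcoord_Ls// mulr0 Dr0.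
by rewrite mulr_sumr; apply: eq_bigr => j _; ring.
Qed.

(** Write d_j = L_j + (x_j/|x|) d_r in the inner derivative: the radial part is a divergence, and in
    the other part the outer d_j may be replaced by L_j because the L_j u are orthogonal to x. *)
Lemma laplacian_decomposition u : good u ->
  \sum_j rpartial j (rpartial j u) =
  Dr (Dr u) + cst (n%:R - 1) * (normV * Dr u) + \sum_j Ls j (Ls j u).
Proof.
move=> gu; have gD := good_Dr gu; have gL j := good_Ls j gu.
rewrite -sum_partial_radial//.
have -> : \sum_j Ls j (Ls j u) = \sum_j rpartial j (Ls j u).
  rewrite {1}/Ls sumrB.
  suff -> : \sum_j xcoord j * (normV * Dr (Ls j u)) = 0 by rewrite subr0.
  under eq_bigr do rewrite -Dr_xcoord_normV//.
  rewrite -Dr_sum => [|j]; last by apply: good_xcoord; exact: good_normV.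
  by rewrite sum_xcoord_Ls// Dr0.
rewrite -big_split/=; apply: eq_bigr => j _.
rewrite -good_partialD//; last by apply: good_xcoord; exact: good_normV.
by rewrite /Ls addrC subrK.
Qed.

End good_functions.

(** * The identities for real functions *)

Ltac good_tac := repeat match goal with
  | H : good ?u |- good ?u => exact: H
  | |- good (cst _ * _) => apply: good_cst
  | |- good (xcoord _ * _) => apply: good_xcoord
  | |- good (normV * _) => apply: good_normV
  | |- good (_ * _) => apply: goodM
  | |- good (- _) => apply: goodN
  | |- good (_ + _) => apply: goodD
  | |- good (Dr _) => apply: good_Dr
  | |- good (Ls _ _) => apply: good_Ls
  | |- good (rpartial _ _) => apply: good_partial
  | |- good (\sum_j _) => apply: good_sum => ?
  end.

(* Otherwise rewriting looks for sums and products inside [Dr u] and [Ls j u]. *)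
Opaque Dr Ls.

Section integral_identities.
Context {R : realType} {n : nat}.
Implicit Types (a b u v : 'rV[R]_n -> R) (x : 'rV[R]_n).

(** * Integration by parts and the radial identities *)

Definition rint u : R := \int[lebesgue_rV n]_x u x.

Lemma good_integrable u : good u ->
  (lebesgue_rV n).-integrable [set: 'rV[R]_n] (EFin \o u).
Proof.
by move=> gu; apply: integrable_bounded_support; [exact: good_continuous|case: gu].
Qed.

Lemma rintD u v : good u -> good v -> rint (u + v) = rint u + rint v.
Proof. by move=> gu gv; apply: RintegralD => //; exact: good_integrable. Qed.

Lemma rint_cst (c : R) u : good u -> rint (cst c * u) = c * rint u.
Proof. by move=> gu; apply: RintegralZl => //; exact: good_integrable. Qed.

Lemma rintN u : good u -> rint (- u) = - rint u.
Proof.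
by move=> gu; rewrite (_ : - u = cst (-1) * u) ?rint_cst ?mulN1r//.
Qed.

Lemma rint_mulNl u v : good u -> good v -> rint (- u * v) = - rint (u * v).
Proof. by move=> gu gv; rewrite mulNr rintN//; exact: goodM. Qed.

Lemma rint0 : rint 0 = 0.
Proof. by rewrite -(mul0r (0 : 'rV[R]_n -> R)) (rint_cst 0 good0) mul0r. Qed.

Lemma rint_sum (F : 'I_n -> 'rV[R]_n -> R) :
  (forall j, good (F j)) -> rint (\sum_j F j) = \sum_j rint (F j).
Proof.
move=> gF; elim: index_enum => [|j s IH]; first by rewrite !big_nil rint0.
rewrite !big_cons rintD ?IH//.
by elim/big_ind: _ => //; [exact: good0|exact: goodD].
Qed.

Lemma rint_partial u j : good u -> rint (rpartial j u) = 0.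
Proof.
move=> gu; rewrite /rint /Rintegral integral_partial_eq0//.
- exact: good_continuous.
- by case: gu.
- by move=> x; exact: good_derivable.
- exact: good_continuous (good_partial j gu).
Qed.

Lemma rint_radial_divergence u : good u ->
  rint (Dr u + cst (n%:R - 1) * (normV * u)) = 0.
Proof.
move=> gu; rewrite -sum_partial_radial// rint_sum => [|j]; last by good_tac.
by rewrite big1// => j _; rewrite rint_partial//; good_tac.
Qed.

(** By the Leibniz rule the integrands add up to the sum of the L_j (u L_j v), which
    [sum_Ls_partial] turns into a divergence. *)
Lemma rint_spherical_parts u v : good u -> good v ->
  rint (u * \sum_j Ls j (Ls j v)) = - \sum_j rint (Ls j u * Ls j v).
Proof.
move=> gu gv; apply/eqP; rewrite -addr_eq0 -rint_sum => [|j]; last by good_tac.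
rewrite -rintD; [|by good_tac..].
rewrite mulr_sumr -big_split/= (eq_bigr (fun j => Ls j (u * Ls j v))) => [|j _].
  rewrite sum_Ls_partial// rint_sum => [|j]; last by good_tac.
  by rewrite big1// => j _; rewrite rint_partial//; good_tac.
by rewrite (LsM j gu (good_Ls j gv)) [Ls j v * _]mulrC.
Qed.

Definition rradial_laplacian u := Dr (Dr u) + cst (n%:R - 1) * (normV * Dr u).

Definition rstar u := Dr u + cst ((n%:R - 4) / 2) * (normV * u).

Definition rsharp u := Dr (Dr u) + cst (n%:R - 3) * (normV * Dr u) +
  cst ((n%:R - 4) ^+ 2 / 4) * (normV * (normV * u)).

Local Notation K := (rellich_const R n).

Definition rrellich u := rradial_laplacian u + cst K * (normV * (normV * u)).

Definition rspherical2 u := \sum_j Ls j (Ls j u).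

Lemma good_rradial_laplacian u : good u -> good (rradial_laplacian u).
Proof. by move=> gu; rewrite /rradial_laplacian; good_tac. Qed.

Lemma good_rstar u : good u -> good (rstar u).
Proof. by move=> gu; rewrite /rstar; good_tac. Qed.

Lemma good_rsharp u : good u -> good (rsharp u).
Proof. by move=> gu; rewrite /rsharp; good_tac. Qed.

Lemma good_rrellich u : good u -> good (rrellich u).
Proof. by move=> gu; have := good_rradial_laplacian gu; rewrite /rrellich => ?; good_tac. Qed.

Lemma good_rspherical2 u : good u -> good (rspherical2 u).
Proof. by move=> gu; rewrite /rspherical2; good_tac. Qed.

Lemma radial_identity u : good u ->
  K ^+ 2 * rint (normV * (normV * u) * (normV * (normV * u))) =
  rint (rradial_laplacian u * rradial_laplacian u) - rint (rrellich u * rrellich u)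
  - 2 * K * rint (normV * rstar u * (normV * rstar u)).
Proof.
move=> gu; have g1 := good_rradial_laplacian gu; have g2 := good_rstar gu.
have g3 := good_rrellich gu.
(* The first term removes [u * Dr (Dr u)]; matching the coefficients of
   [u * Dr u] then gives [(n - 2) / 2]. *)
pose V := normV * (normV * (u * Dr u)) +
  cst ((n%:R - 2) / 2) * (normV * (normV * (normV * (u * u)))).
have gV : good V by rewrite /V; good_tac.
have E : rradial_laplacian u * rradial_laplacian u =
    cst (K ^+ 2) * (normV * (normV * u) * (normV * (normV * u))) +
    rrellich u * rrellich u + cst (2 * K) * (normV * rstar u * (normV * rstar u)) +
    cst (- (2 * K)) * (Dr V + cst (n%:R - 1) * (normV * V)).
  (* Once the Leibniz rules are applied, the identity is polynomial in the values of u, [Dr u],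
     [Dr (Dr u)] and [normV] at a point. *)
  rewrite /V DrD ?Dr_cst ?Dr_normV ?DrM; [|by good_tac..].
  apply/funext => x; rewrite /rrellich /rradial_laplacian /rstar /rellich_const !fctE.
  by field.
by rewrite E !rintD ?rint_cst ?rint_radial_divergence; [ring|good_tac..].
Qed.

Lemma sharp_identity u : good u ->
  rint (rrellich u * rrellich u) = rint (rsharp u * rsharp u) +
  4 * rint (normV * rstar u * (normV * rstar u)).
Proof.
move=> gu; have g1 := good_rsharp gu; have g2 := good_rstar gu.
have g3 := good_rrellich gu.
(* [rrellich u] and [rsharp u] are [Dr g + c * normV * g] for [g = rstar u],
   with [c = (n + 2) / 2] and [c = (n - 2) / 2]. *)
pose V := normV * (rstar u * rstar u).
have gV : good V by rewrite /V; good_tac.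
have E : rrellich u * rrellich u = rsharp u * rsharp u +
    cst 4 * (normV * rstar u * (normV * rstar u)) +
    cst 2 * (Dr V + cst (n%:R - 1) * (normV * V)).
  rewrite /V Dr_normV ?DrM ?[Dr (rstar u)]DrD ?Dr_cst ?Dr_normV; [|by good_tac..].
  apply/funext => x; rewrite /rrellich /rradial_laplacian /rsharp /rstar /rellich_const !fctE.
  by field.
by rewrite E !rintD ?rint_cst ?rint_radial_divergence; [ring|good_tac..].
Qed.

(** Commuting L_j with d_r and 1/|x| leaves radial expressions in b = L_j u alone, which differ by a
    radial divergence. *)
Lemma spherical_component_identity u j : good u ->
  - (2 * rint (Ls j (rradial_laplacian u) * Ls j u)) =
  2 * K * rint (normV * Ls j u * (normV * Ls j u)) +
  2 * rint (Ls j (rstar u) * Ls j (rstar u)).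
Proof.
move=> gu; have g1 := good_rradial_laplacian gu; have g2 := good_rstar gu.
(* Here b is kept abstract, so that the rewriting rules treat it as an atom. *)
have [b bE] : exists b, b = Ls j u by exists (Ls j u).
have gb : good b by rewrite bE; good_tac.
rewrite -bE.
have LD : Ls j (Dr u) = Dr b + normV * b by rewrite Ls_Dr// bE.
have LDD : Ls j (Dr (Dr u)) = Dr (Dr b) + cst 2 * (normV * Dr b).
  rewrite Ls_Dr ?LD ?DrD ?Dr_normV; [|by good_tac..].
  by apply/funext => x; rewrite !fctE; ring.
have LR : Ls j (rradial_laplacian u) = Dr (Dr b) + cst 2 * (normV * Dr b) +
    cst (n%:R - 1) * (normV * (Dr b + normV * b)).
  by rewrite LsD ?Ls_cst ?Ls_normV ?LDD ?LD; [|good_tac..].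
have LS : Ls j (rstar u) = Dr b + normV * b + cst ((n%:R - 4) / 2) * (normV * b).
  rewrite /rstar LsD ?Ls_cst ?Ls_normV ?LD -?bE; [|good_tac..].
  by [].
(* The first term accounts for [b * Dr (Dr b)] and cancels the square of [Dr b]; comparing the
   coefficients of [normV * b * Dr b] then gives -n. *)
pose V := cst (- 2) * (b * Dr b) + cst (- n%:R) * (normV * (b * b)).
have gV : good V by rewrite /V; good_tac.
have E : cst (- 2) * (Ls j (rradial_laplacian u) * b) =
    cst (2 * K) * (normV * b * (normV * b)) + cst 2 * (Ls j (rstar u) * Ls j (rstar u)) +
    (Dr V + cst (n%:R - 1) * (normV * V)).
  rewrite /V DrD ?Dr_cst ?Dr_normV ?DrM; [|by good_tac..].
  by apply/funext => x; rewrite LR LS /rellich_const !fctE; field.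
have := congr1 rint E.
rewrite !rintD ?rint_cst; [|by good_tac..].
have := rint_radial_divergence gV; rewrite rintD ?rint_cst; [|by good_tac..].
by move=> ->; rewrite addr0 mulNr.
Qed.

Lemma laplacian_identity u : good u ->
  rint ((\sum_j rpartial j (rpartial j u)) * \sum_j rpartial j (rpartial j u)) =
  rint (rradial_laplacian u * rradial_laplacian u) +
  rint (rspherical2 u * rspherical2 u) +
  2 * K * (\sum_j rint (normV * Ls j u * (normV * Ls j u))) +
  2 * rint (- rspherical2 (rstar u) * rstar u).
Proof.
move=> gu; have g1 := good_rradial_laplacian gu; have g2 := good_rstar gu.
have gS := good_rspherical2 gu; have g3 := good_rspherical2 g2.
have sqE (p q : 'rV[R]_n -> R) : (p + q) * (p + q) = p * p + q * q + cst 2 * (p * q).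
  by apply/funext => x; rewrite !fctE; ring.
have sqI (p q : 'rV[R]_n -> R) : good p -> good q ->
    rint ((p + q) * (p + q)) = rint (p * p) + rint (q * q) + 2 * rint (p * q).
  by move=> gp gq; rewrite sqE !rintD ?rint_cst//; good_tac.
rewrite laplacian_decomposition// (sqI _ _ g1 gS) (rint_mulNl g3 g2).
rewrite -[RHS]addrA; congr (_ + _).
(* Integration by parts turns the cross term and the term in [rstar u] into sums over j, which
   [spherical_component_identity] relates term by term. *)
have E1 : rint (rradial_laplacian u * rspherical2 u) = _ := rint_spherical_parts g1 gu.
have E2 : rint (rstar u * rspherical2 (rstar u)) = _ := rint_spherical_parts g2 g2.
have E3 : rspherical2 (rstar u) * rstar u = rstar u * rspherical2 (rstar u).
  by apply/funext => x; exact: (mulrC (rspherical2 (rstar u) x) (rstar u x)).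
transitivity (2 * - \sum_j rint (Ls j (rradial_laplacian u) * Ls j u)).
  exact: (congr1 ( *%R 2) E1).
transitivity (2 * K * (\sum_j rint (normV * Ls j u * (normV * Ls j u))) +
    2 * - - \sum_j rint (Ls j (rstar u) * Ls j (rstar u))); last first.
  exact: (congr1 (fun z => _ + 2 * - z) (etrans (esym E2) (congr1 rint (esym E3)))).
have sumE (F G H : 'I_n -> R) (c : R) : (forall j, - (2 * F j) = c * G j + 2 * H j) ->
    2 * - (\sum_j F j) = c * (\sum_j G j) + 2 * - - \sum_j H j.
  by move=> FGH; rewrite opprK mulrN !mulr_sumr -sumrN -big_split/=; exact: eq_bigr.
exact: (sumE _ _ _ _ (fun j => spherical_component_identity j gu)).
Qed.

(** Integration by parts gives an expression symmetric in u and v. This symmetry makes the inner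
    product in the theorem real. *)
Lemma rint_spherical2C u v : good u -> good v ->
  rint (u * rspherical2 v) = rint (v * rspherical2 u).
Proof.
move=> gu gv; apply: etrans (rint_spherical_parts gu gv) _.
apply: etrans (esym (rint_spherical_parts gv gu)).
apply: (congr1 -%R); apply: eq_bigr => j _.
exact: (congr1 rint (mulrC (Ls j u) (Ls j v))).
Qed.

End integral_identities.

Transparent Dr Ls.

(** * Complex-valued functions *)

Section complex_valued.
Context {R : realType} {n : nat}.
Implicit Types (a b u v : 'rV[R]_n -> R) (x : 'rV[R]_n).

(** Each complex operator applied to [mkc a b] is shown to be [mkc] of its real counterpart applied
    to a and b. *)
Definition mkc a b : 'rV[R]_n -> R[i] := fun x => a x +i* b x.

Lemma Re_sum (F : 'I_n -> R[i]) :
  complex.Re (\sum_j F j) = \sum_j complex.Re (F j).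
Proof. by apply: (big_morph (@complex.Re R)) => // -[p q] [p' q']. Qed.

Lemma Im_sum (F : 'I_n -> R[i]) :
  complex.Im (\sum_j F j) = \sum_j complex.Im (F j).
Proof. by apply: (big_morph (@complex.Im R)) => // -[p q] [p' q']. Qed.

Lemma mkc_sum (A B : 'I_n -> 'rV[R]_n -> R) x :
  \sum_j mkc (A j) (B j) x = mkc (\sum_j A j) (\sum_j B j) x.
Proof. by apply/eqP; rewrite eq_complex Re_sum Im_sum /= !fct_sumE !eqxx. Qed.

Lemma mulC_mkc (c : R) a b x : c%:C * mkc a b x = (c * a x) +i* (c * b x).
Proof. by apply/eqP; rewrite eq_complex /= !mul0r subr0 addr0 !eqxx. Qed.

Lemma mkcD a b a' b' x : mkc a b x + mkc a' b' x = mkc (a + a') (b + b') x.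
Proof. by []. Qed.

Lemma mkc_cst (c : R) a b x : c%:C * mkc a b x = mkc (cst c * a) (cst c * b) x.
Proof. exact: mulC_mkc. Qed.

Lemma partial_mkc j a b : partial j (mkc a b) = mkc (rpartial j a) (rpartial j b).
Proof. by []. Qed.

Lemma radial_mkc a b : radial (mkc a b) = mkc (Dr a) (Dr b).
Proof.
apply/funext => x; rewrite /radial /Dr -mkc_sum; apply: eq_bigr => j _.
by rewrite partial_mkc mulC_mkc /mkc !fctE !mulrA.
Qed.

Lemma over_norm_mkc1 a b : over_norm 1 (mkc a b) = mkc (normV * a) (normV * b).
Proof.
apply/funext => x; rewrite /over_norm expr1 -fmorphV mulrC /= mulC_mkc.
by rewrite /mkc !fctE.
Qed.

Lemma over_norm_mkc2 a b :
  over_norm 2 (mkc a b) = mkc (normV * (normV * a)) (normV * (normV * b)).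
Proof.
apply/funext => x; rewrite /over_norm -fmorphV mulrC /= mulC_mkc -exprVn expr2 -!mulrA.
by rewrite /mkc !fctE.
Qed.

Lemma radial_laplacian_mkc a b : radial_laplacian (mkc a b) =
  mkc (rradial_laplacian a) (rradial_laplacian b).
Proof.
apply/funext => x; rewrite /radial_laplacian !radial_mkc over_norm_mkc1.
have -> : n%:R - 1 = (n%:R - 1)%:C :> R[i] by rewrite rmorphB rmorph_nat rmorph1.
by rewrite mkc_cst mkcD.
Qed.

Lemma spherical_mkc j a b : spherical j (mkc a b) = mkc (Ls j a) (Ls j b).
Proof.
apply/funext => x; rewrite /spherical /Ls radial_mkc partial_mkc mulC_mkc.
by rewrite /mkc !fctE -!mulrA.
Qed.

Lemma sum_spherical2_mkc a b :
  sum_spherical2 (mkc a b) = mkc (rspherical2 a) (rspherical2 b).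
Proof.
apply/funext => x; rewrite /sum_spherical2 /rspherical2 -mkc_sum.
by apply: eq_bigr => j _; rewrite !spherical_mkc.
Qed.

Lemma laplacian_mkc a b : laplacian (mkc a b) =
  mkc (\sum_j rpartial j (rpartial j a)) (\sum_j rpartial j (rpartial j b)).
Proof. by apply/funext => x; rewrite /laplacian -mkc_sum. Qed.

Lemma f_star_mkc a b : f_star (mkc a b) = mkc (rstar a) (rstar b).
Proof.
apply/funext => x; rewrite /f_star radial_mkc over_norm_mkc1.
have -> : (n%:R - 4) / 2 = ((n%:R - 4) / 2)%:C :> R[i].
  by rewrite fmorph_div rmorphB !rmorph_nat.
by rewrite mkc_cst mkcD.
Qed.

Lemma f_sharp_mkc a b : f_sharp (mkc a b) = mkc (rsharp a) (rsharp b).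
Proof.
apply/funext => x; rewrite /f_sharp !radial_mkc over_norm_mkc1 over_norm_mkc2.
have -> : n%:R - 3 = (n%:R - 3)%:C :> R[i] by rewrite rmorphB !rmorph_nat.
have -> : (n%:R - 4) ^+ 2 / 4 = ((n%:R - 4) ^+ 2 / 4)%:C :> R[i].
  by rewrite fmorph_div rmorphXn rmorphB !rmorph_nat.
by rewrite !mkc_cst !mkcD.
Qed.

(** Pointwise |g|^2 = a^2 + b^2. The hypothesis on g is an equation so that the lemmas computing an
    operator on [mkc] can be supplied directly. *)
Lemma L2norm_mkc (g : 'rV[R]_n -> R[i]) a b : g = mkc a b -> good a -> good b ->
  L2norm g ^+ 2 = rint (a * a) + rint (b * b).
Proof.
move=> -> ga gb; have gaa := goodM ga ga; have gbb := goodM gb gb.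
have E : (\int[lebesgue_rV n]_x (`|(ComplexField.Normc.normc (mkc a b x))%:E| `^ 2)%E =
          (rint (a * a + b * b))%:E)%E.
  rewrite /rint /Rintegral fineK; last first.
    by apply: integrable_fin_num => //; apply: good_integrable; exact: goodD.
  apply: eq_integral => x _; rewrite abse_EFin poweR_EFin; congr EFin.
  rewrite /mkc/= ger0_norm ?sqrtr_ge0// powR_mulrn ?sqrtr_ge0// sqr_sqrtr; last first.
    by rewrite addr_ge0// sqr_ge0.
  by rewrite !fctE -!expr2.
have i0 : 0 <= rint (a * a + b * b).
  by apply: Rintegral_ge0 => x _; rewrite !fctE addr_ge0// -expr2 sqr_ge0.
(* The norm is the power 1/2 of the integral; its square is rewritten as a real power so that the
   exponents multiply to 1. *)
rewrite -rintD// /L2norm unlock E poweR_EFin /= -powR_mulrn ?powR_ge0//.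
by rewrite -powRrM mulVf ?powRr1// pnatr_eq0.
Qed.

Lemma L2inner_mkc a b a' b' : good a -> good b -> good a' -> good b' ->
  L2inner (mkc a b) (mkc a' b') =
  (rint (a * a') + rint (b * b')) +i* (rint (b * a') - rint (a * b')).
Proof.
move=> ga gb ga' gb'; rewrite /L2inner; congr (_ +i* _).
  rewrite -rintD; [|exact: goodM..]; congr rint; apply/funext => x.
  by rewrite /mkc !fctE /=; ring.
rewrite -rintN -?rintD; [|by repeat first [exact: goodM | apply: goodN]..].
by congr rint; apply/funext => x; rewrite /mkc !fctE /=; ring.
Qed.

Lemma test_function_mkc (f : 'rV[R]_n -> R[i]) : test_function f ->
  exists a b, [/\ f = mkc a b, good a & good b].
Proof.
move=> [sf cf f0]; exists (fun x => complex.Re (f x)), (fun x => complex.Im (f x)).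
have [M fM] : exists M : R, forall x, M < `|x| -> f x = 0.
  (* [compact_bounded] gives a bound by every number strictly above M, hence M + 1. *)
  have [M [_ fM]] := compact_bounded cf; exists (M + 1) => x Mx; apply/eqP/negPn/negP => fx.
  have : `|x| <= M + 1 by apply: fM; [rewrite ltrDl|exact: subset_closure].
  by rewrite leNgt Mx.
have [d d0 fd] : exists2 d : R, 0 < d & forall x, `|x| < d -> f x = 0.
  have /open_nbhs_nbhs : open_nbhs (0 : 'rV[R]_n) (~` Defs.support f).
    by split=> //; apply: closed_openC; exact: closed_closure.
  move=> /nbhs_ballP[d /= d0 fd]; exists d => // x xd; apply/eqP/negPn/negP => fx.
  apply: (fd x); last exact: subset_closure.
  by rewrite -ball_normE /= sub0r normrN.
(* Quantifying over s lets the induction pass to a further derivative, which is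
   [partials (j :: s) f]. *)
have CRe k : forall s, Ck k (fun x => complex.Re (partials s f x)).
  elim: k => [|k IH] s; have [c1 c2 d1] := sf s; split => // j; split.
    by move=> x; have [] := d1 j x.
  exact: (IH (j :: s)).
have CIm k : forall s, Ck k (fun x => complex.Im (partials s f x)).
  elim: k => [|k IH] s; have [c1 c2 d1] := sf s; split => // j; split.
    by move=> x; have [] := d1 j x.
  exact: (IH (j :: s)).
split.
- by apply/funext => x; rewrite /mkc; case: (f x).
- split; first by move=> k; exact: (CRe k [::]).
    by exists d => // x xd; rewrite fd.
  by exists M => x xM; rewrite fM.
- split; first by move=> k; exact: (CIm k [::]).
    by exists d => // x xd; rewrite fd.
  by exists M => x xM; rewrite fM.
Qed.

End complex_valued.

(** * Adding the identities for the real and imaginary parts *)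

Section real_and_imaginary_parts.
Context {R : realType}.
Implicit Types K X Q Y Z S T x r y z s t : R.

Lemma add_radial_identity K X Q Y S x x' r r' y y' s s' :
  X = x + x' -> Q = r + r' -> Y = y + y' -> S = s + s' ->
  K ^+ 2 * x = r - y - 2 * K * s -> K ^+ 2 * x' = r' - y' - 2 * K * s' ->
  K ^+ 2 * X = Q - Y - 2 * K * S.
Proof. by move=> -> -> -> -> h h'; rewrite mulrDr h h'; ring. Qed.

(** The two sides differ by K/2 (Y - Z) - 2 K S, which vanishes because Y = Z + 4 S. *)
Lemma add_sharp_identity K Q Y Z S y y' z z' s s' :
  Y = y + y' -> Z = z + z' -> S = s + s' ->
  y = z + 4 * s -> y' = z' + 4 * s' ->
  Q - Y - 2 * K * S = Q - (1 + K / 2) * Y + K / 2 * Z.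
Proof. by move=> -> -> -> -> ->; field. Qed.

Lemma add_laplacian_identity K X Q Y T (S : R[i]) x x' r r' y y' t t' s s' :
  X = x + x' -> Q = r + r' -> Y = y + y' -> T = t + t' -> S = (s + s')%:C ->
  x = r + y + 2 * K * t + 2 * s -> x' = r' + y' + 2 * K * t' + 2 * s' ->
  X%:C = Q%:C + Y%:C + (2 * K * T)%:C + 2 * S.
Proof.
move=> -> -> -> -> -> -> ->; have -> : 2 = 2%:C :> R[i] by rewrite rmorph_nat.
by rewrite -rmorphM -!rmorphD; congr (_%:C); ring.
Qed.

End real_and_imaginary_parts.

Theorem theorem1 (R : realType) (n : nat) (f : 'rV[R]_n -> R[i]) :
  (2 <= n)%N -> test_function f ->
  let Rn : R := rellich_const R n in
  let A : 'rV[R]_n -> R[i] := fun x =>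
    radial_laplacian f x + Rn%:C * over_norm 2 f x in
  [/\ Rn ^+ 2 * L2norm (over_norm 2 f) ^+ 2 =
        L2norm (radial_laplacian f) ^+ 2 - L2norm A ^+ 2
        - 2 * Rn * L2norm (over_norm 1 (f_star f)) ^+ 2,
      L2norm (radial_laplacian f) ^+ 2 - L2norm A ^+ 2
        - 2 * Rn * L2norm (over_norm 1 (f_star f)) ^+ 2 =
        L2norm (radial_laplacian f) ^+ 2 - (1 + Rn / 2) * L2norm A ^+ 2
        + Rn / 2 * L2norm (f_sharp f) ^+ 2 &
      (L2norm (laplacian f) ^+ 2)%:C =
        (L2norm (radial_laplacian f) ^+ 2)%:C
        + (L2norm (sum_spherical2 f) ^+ 2)%:C
        + (2 * Rn * \sum_(j < n) L2norm (over_norm 1 (spherical j f)) ^+ 2)%:C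
        + 2 * L2inner (fun x => - sum_spherical2 (f_star f) x) (f_star f)].
Proof.
move=> _ tf; have [a [b [-> ga gb]]] := test_function_mkc tf => Rn A.
have gra := good_rradial_laplacian ga; have grb := good_rradial_laplacian gb.
have gsa := good_rstar ga; have gsb := good_rstar gb.
have g2a := good_rspherical2 gsa; have g2b := good_rspherical2 gsb.
have AE : A = mkc (rrellich a) (rrellich b).
  apply/funext => x; rewrite /A radial_laplacian_mkc over_norm_mkc2 mkc_cst.
  exact: mkcD.
have NW := L2norm_mkc (over_norm_mkc2 a b) (good_normV (good_normV ga))
  (good_normV (good_normV gb)).
have NR := L2norm_mkc (radial_laplacian_mkc a b) gra grb.
have NA := L2norm_mkc AE (good_rrellich ga) (good_rrellich gb).
have fE := f_star_mkc a b.
have NS := L2norm_mkc (etrans (congr1 (over_norm 1) fE) (over_norm_mkc1 _ _))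
  (good_normV gsa) (good_normV gsb).
have NH := L2norm_mkc (f_sharp_mkc a b) (good_rsharp ga) (good_rsharp gb).
have gL (u : 'rV[R]_n -> R) : good u -> good (\sum_j rpartial j (rpartial j u))
  by move=> gu; good_tac.
have NL := L2norm_mkc (laplacian_mkc a b) (gL a ga) (gL b gb).
have N2 := L2norm_mkc (sum_spherical2_mkc a b) (good_rspherical2 ga) (good_rspherical2 gb).
have NT j := L2norm_mkc (etrans (congr1 (over_norm 1) (spherical_mkc j a b))
    (over_norm_mkc1 _ _))
  (good_normV (good_Ls j ga)) (good_normV (good_Ls j gb)).
have SE : (fun x => - sum_spherical2 (f_star (mkc a b)) x) =
    mkc (- rspherical2 (rstar a)) (- rspherical2 (rstar b)).
  by rewrite fE; apply/funext => x; rewrite sum_spherical2_mkc.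
(* The imaginary part of the inner product vanishes by symmetry of the sum of the L_j^2. *)
have Im0 : rint (- rspherical2 (rstar b) * rstar a) -
    rint (- rspherical2 (rstar a) * rstar b) = 0.
  apply/eqP; rewrite subr_eq0; apply/eqP.
  apply: etrans (rint_mulNl g2b gsa) _; apply: etrans (esym (rint_mulNl g2a gsb)).
  apply: (congr1 -%R).
  apply: etrans (congr1 rint (mulrC (rspherical2 (rstar b)) (rstar a))) _.
  apply: etrans (rint_spherical2C gsa gsb) _.
  exact: (congr1 rint (mulrC (rstar b) (rspherical2 (rstar a)))).
have IE := etrans (congr2 L2inner SE fE)
  (etrans (L2inner_mkc (goodN g2a) (goodN g2b) gsa gsb) (congr1 (fun z => _ +i* z) Im0)).
split.
- exact: (add_radial_identity NW NR NA NS (radial_identity ga) (radial_identity gb)).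
- exact: (add_sharp_identity _ _ NA NH NS (sharp_identity ga) (sharp_identity gb)).
(* The sum over j of the squared norms is split into the sums for the real part and for the
   imaginary part. *)
- exact: (add_laplacian_identity NL NR N2
    (etrans (eq_bigr _ (fun j _ => NT j)) (big_split _ _ _ _ _)) IE (laplacian_identity ga) (laplacian_identity gb)).
Qed.
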